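(* Let $S$ be a numerical semigroup with $n=13$, and consider the finite support kernel described in the context. The minimal complete supports for the claim $v$ are $$G=\{p_n,j_*,i_e,i_q,i_4,i_h\},\qquad B_j=\{p_n,i_j,p_j,a_j\}\quad(j\in J).$$ For $J(S)=\{j\in J:H_j(S)\}$ and available resources $W\subseteq U_{\mathrm{ar}}$, a registered sound derivation of $C(S)$ in this kernel survives exactly when $$[G\subseteq W]\ \vee\ \bigvee_{j\in J(S)}[B_j\subseteq W].$$ Equivalently, a withdrawal $D=U_{\mathrm{ar}}\setminus W$ destroys all registered sound derivations exactly when $D$ meets $G$ and every $B_j$ with $j\in J(S)$.
   Context: For a numerical semigroup $S$ (cofinite additive submonoid of $\mathbb N$) let $m$ be its least positive element, $c$ its conductor (least $c$ with $c+\mathbb N\subseteq S$), $n=|S\cap[0,c)|$, $e$ the number of its primitive elements (positive elements not sums of two positive elements of $S$), $q=\lceil c/m\rceil$. Write $C(S)$ for $c\le13e$. Let $J=\{e,q,4,h\}$ and $$H_e:(e\le3),\quad H_q:(q\le3),\quad H_4:(e\ge4\wedge q=4),\quad H_h:(e\ge4\wedge q\ge5).$$ A finite support kernel consists of disjoint finite sets $\mathcal P$ of premises (each with a formula), $\mathcal V$ of claims (each with a formula), and $\mathcal E$ of artifacts; each artifact $a\in\mathcal E$ has a set of premises $A_a\subseteq\mathcal P$, a set of prerequisite claims $B_a\subseteq\mathcal V$, a conclusion $c_a\in\mathcal V$, and a checked derivation of the formula of $c_a$ from the formulas of $A_a\cup B_a$. A complete derivation tree of a claim $w$ has a root artifact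 with conclusion $w$ and, recursively, a complete derivation tree of each prerequisite claim of that artifact; its support is the set of all artifacts used together with all premises in their sets $A_a$. A derivation survives for $W\subseteq\mathcal P\sqcup\mathcal E$ if its support is contained in $W$; it is sound for $S$ if all premise formulas in its support hold for $S$. A minimal complete support for a claim is an inclusion-minimal support of a complete derivation tree of that claim. The kernel at hand has token space $U_{\mathrm{ar}}=\mathcal P\sqcup\mathcal E$ with premises $p_n:(n=13)$ and $p_j:H_j(S)$ for $j\in J$; claims $v:C(S)$ and $v_j:(H_j(S)\Rightarrow C(S))$ for $j\in J$; and exactly the following artifacts: for $j\in J$, $i_j$ with premise set $\{p_n\}$, no prerequisite claims, conclusion $v_j$; for $j\in J$, $a_j$ with premise set $\{p_j\}$, prerequisite $\{v_j\}$, conclusion $v$; and $j_*$ with no premises, prerequisites $\{v_e,v_q,v_4,v_h\}$, conclusion $v$ (using that the four predicates $H_j$ are exhaustive). *)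

(* Defs.v *)
From HB Require Import structures.
From mathcomp Require Import all_boot.
From mathcomp Require Import boolp.
From mathcomp Require Import zify.

Set Implicit Arguments.
Unset Strict Implicit.
Unset Printing Implicit Defensive.

(* Cofinite subsets of nat are decidable, so a boolean carrier is no loss. *)
Record numsg := NumSg {
  sg_mem :> pred nat;
  sg0 : sg_mem 0;
  sgD : forall x y, sg_mem x -> sg_mem y -> sg_mem (x + y);
  sg_cofinite : exists N, forall x, N <= x -> sg_mem x }.

Lemma multiplicity_ex (S : numsg) : exists x, (0 < x) && S x.
Proof. by have [N hN] := sg_cofinite S; exists N.+1; rewrite hN. Qed.

Definition multiplicity (S : numsg) : nat := ex_minn (multiplicity_ex S).

Lemma conductor_ex (S : numsg) : exists c, `[< forall k, S (c + k) >].
Proof.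
have [N hN] := sg_cofinite S; exists N; apply/asboolP => k.
exact/hN/leq_addr.
Qed.

Definition conductor (S : numsg) : nat := ex_minn (conductor_ex S).

Definition nleft (S : numsg) : nat := #|[set x : 'I_(conductor S) | S x]|.

Definition primitive (S : numsg) (x : nat) : Prop :=
  [/\ 0 < x, S x
    & ~ exists y z, [/\ 0 < y, S y, 0 < z, S z & x = y + z]].

(* Equality occurs for S = nat, where c = 0, m = 1 and 1 is primitive. *)
Lemma primitive_le (S : numsg) x :
  primitive S x -> x <= conductor S + multiplicity S.
Proof.
case=> x0 Sx nsum; rewrite leqNgt; apply/negP => hx; apply: nsum.
move: hx; rewrite /conductor /multiplicity.
case: ex_minnP => c /asboolP hc _; case: ex_minnP => m /andP[m0 Sm] _ hx.
exists m, (x - m); split=> //; [lia| |lia].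
by rewrite (_ : x - m = c + (x - m - c)); [exact: hc | lia].
Qed.

(* By primitive_le, the bounded range misses no primitive element. *)
Definition nprim (S : numsg) : nat :=
  #|[set x : 'I_(conductor S + multiplicity S).+1 | `[< primitive S x >]]|.

(* The ceiling of c / m. *)
Definition depth (S : numsg) : nat :=
  (conductor S + (multiplicity S).-1) %/ multiplicity S.

Definition formula := numsg -> Prop.

(* Disjointness of premises, claims and artifacts is by typing; a checked
   derivation is a Rocq proof, uniform in the semigroup. *)
Record kernel := Kernel {
  premise : finType;
  claim : finType;
  artifact : finType;
  prem_formula : premise -> formula;
  claim_formula : claim -> formula;
  art_prems : artifact -> {set premise};
  art_prereqs : artifact -> {set claim};
  art_concl : artifact -> claim;
  art_deriv : forall (a : artifact) (S : numsg),
    (forall p, p \in art_prems a -> prem_formula p S) ->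
    (forall b, b \in art_prereqs a -> claim_formula b S) ->
    claim_formula (art_concl a) S }.

Definition token (K : kernel) : finType := (premise K + artifact K)%type.

Inductive dtree (K : kernel) : claim K -> Type :=
  DNode (a : artifact K)
    (sub : forall b : {b : claim K | b \in art_prereqs a}, dtree (val b)) :
    dtree (art_concl a).

Fixpoint tsupport (K : kernel) (w : claim K) (t : dtree w) : {set token K} :=
  match t with
  | DNode a sub =>
      (inr a : token K) |: [set (inl p : token K) | p in art_prems a]
        :|: \bigcup_(b : {b : claim K | b \in art_prereqs a}) tsupport (sub b)
  end.

Definition survives (K : kernel) (W : {set token K}) (w : claim K)
  (t : dtree w) : Prop := tsupport t \subset W.

Definition sound (K : kernel) (S : numsg) (w : claim K) (t : dtree w) : Prop :=
  forall p : premise K, (inl p : token K) \in tsupport t -> prem_formula p S.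

Definition complete_support (K : kernel) (w : claim K) (X : {set token K}) :=
  exists t : dtree w, tsupport t = X.

Definition minimal_complete_support (K : kernel) (w : claim K)
  (X : {set token K}) : Prop :=
  complete_support w X /\
  forall Y : {set token K}, complete_support w Y -> Y \subset X -> Y = X.

Inductive J := Je | Jq | J4 | Jh.

Definition J_code (j : J) : 'I_4 :=
  match j with
  | Je => @Ordinal 4 0 isT | Jq => @Ordinal 4 1 isT
  | J4 => @Ordinal 4 2 isT | Jh => @Ordinal 4 3 isT
  end.
Definition J_decode (i : 'I_4) : J :=
  match val i with 0 => Je | 1 => Jq | 2 => J4 | _ => Jh end.
Lemma J_codeK : cancel J_code J_decode. Proof. by case. Qed.
HB.instance Definition _ := Finite.copy J (can_type J_codeK).

Definition wilf13 : formula := fun S => conductor S <= 13 * nprim S.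

Definition H (j : J) (S : numsg) : bool :=
  match j with
  | Je => nprim S <= 3
  | Jq => depth S <= 3
  | J4 => (4 <= nprim S) && (depth S == 4)
  | Jh => (4 <= nprim S) && (5 <= depth S)
  end.

Definition Jof (S : numsg) : {set J} := [set j | H j S].

Inductive ar_premise := P_n | P_ of J.

Definition ar_premise_code (p : ar_premise) : option J :=
  if p is P_ j then Some j else None.
Definition ar_premise_decode (o : option J) : ar_premise :=
  if o is Some j then P_ j else P_n.
Lemma ar_premise_codeK : cancel ar_premise_code ar_premise_decode.
Proof. by case. Qed.
HB.instance Definition _ := Finite.copy ar_premise (can_type ar_premise_codeK).

Inductive ar_claim := V | V_ of J.

Definition ar_claim_code (v : ar_claim) : option J :=
  if v is V_ j then Some j else None.
Definition ar_claim_decode (o : option J) : ar_claim :=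
  if o is Some j then V_ j else V.
Lemma ar_claim_codeK : cancel ar_claim_code ar_claim_decode.
Proof. by case. Qed.
HB.instance Definition _ := Finite.copy ar_claim (can_type ar_claim_codeK).

Inductive ar_artifact := I_ of J | A_ of J | J_star.

Definition ar_artifact_code (a : ar_artifact) : option (J + J) :=
  match a with I_ j => Some (inl j) | A_ j => Some (inr j) | J_star => None end.
Definition ar_artifact_decode (o : option (J + J)) : ar_artifact :=
  match o with
  | Some (inl j) => I_ j | Some (inr j) => A_ j | None => J_star
  end.
Lemma ar_artifact_codeK : cancel ar_artifact_code ar_artifact_decode.
Proof. by case. Qed.
HB.instance Definition _ :=
  Finite.copy ar_artifact (can_type ar_artifact_codeK).

Definition ar_prem_formula (p : ar_premise) : formula := fun S =>
  match p with P_n => nleft S = 13 | P_ j => H j S end.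

Definition ar_claim_formula (v : ar_claim) : formula := fun S =>
  match v with V => wilf13 S | V_ j => H j S -> wilf13 S end.

Definition ar_prems (a : ar_artifact) : {set ar_premise} :=
  match a with I_ _ => [set P_n] | A_ j => [set P_ j] | J_star => set0 end.

Definition ar_prereqs (a : ar_artifact) : {set ar_claim} :=
  match a with
  | I_ _ => set0
  | A_ j => [set V_ j]
  | J_star => [set V_ Je; V_ Jq; V_ J4; V_ Jh]
  end.

Definition ar_concl (a : ar_artifact) : ar_claim :=
  match a with I_ j => V_ j | A_ _ => V | J_star => V end.

Lemma H_exhaustive (S : numsg) : exists j, H j S.
Proof.
have [e3|e4] := leqP (nprim S) 3; first by exists Je.
have [q3|] := leqP (depth S) 3; first by exists Jq.
rewrite leq_eqVlt => /orP[/eqP q4|q5].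
  by exists J4; rewrite /= e4 -q4.
by exists Jh; rewrite /= e4.
Qed.

(* The i_j are given with their derivations, so the kernel is parametrised by
   them; those of the a_j and of j_star are constructed in ar_deriv. *)
Definition branch_derivations : Prop :=
  forall (j : J) (S : numsg), nleft S = 13 -> H j S -> wilf13 S.

Lemma ar_deriv (di : branch_derivations) (a : ar_artifact) (S : numsg) :
  (forall p, p \in ar_prems a -> ar_prem_formula p S) ->
  (forall b, b \in ar_prereqs a -> ar_claim_formula b S) ->
  ar_claim_formula (ar_concl a) S.
Proof.
case: a => [j|j|] /= hp hb.
- by apply: di; apply: (hp P_n); rewrite inE.
- by apply: (hb (V_ j)); rewrite ?inE //; apply: (hp (P_ j)); rewrite inE.
- have [j hj] := H_exhaustive S.
  by apply: (hb (V_ j)) hj; rewrite !inE; case: j.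
Qed.

Definition arK (di : branch_derivations) : kernel :=
  Kernel (ar_deriv di).

Definition ar_token : finType := (ar_premise + ar_artifact)%type.

Definition supG : {set ar_token} :=
  [set inl P_n; inr J_star; inr (I_ Je); inr (I_ Jq); inr (I_ J4); inr (I_ Jh)].

Definition supB (j : J) : {set ar_token} :=
  [set inl P_n; inr (I_ j); inl (P_ j); inr (A_ j)].

(* Main.v *)
(** Every claim other than [v] has exactly one derivation tree up to its
    support, namely [i_j] with support [{p_n, i_j}].  A tree for [v] is rooted
    either at [a_j], with support [B_j], or at [j_*], with support [G].  These
    five sets form an antichain, and the only premises they contain that can
    fail for a semigroup with [n = 13] are the [p_j], with [p_j] in [B_j]. *)
Require Import Defs.
From mathcomp Require Import all_boot.

Set Implicit Arguments.
Unset Strict Implicit.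
Unset Printing Implicit Defensive.

(** When the support of each subtree depends only on its conclusion, the union over the sigma type
    of prerequisites becomes an ordinary union over a set, which the [bigop] lemmas can compute. *)
Lemma tsupport_DNode (K : kernel) (a : artifact K)
    (sub : forall b : {b : claim K | b \in art_prereqs a}, dtree (val b))
    (F : claim K -> {set token K}) :
  (forall b, tsupport (sub b) = F (val b)) ->
  tsupport (DNode sub) =
    (inr a : token K) |: [set (inl p : token K) | p in art_prems a]
      :|: \bigcup_(b in art_prereqs a) F b.
Proof.
move=> hF /=; congr (_ :|: _); apply/setP => x.
apply/bigcupP/bigcupP => [[b _]|[b hb xb]].
  by rewrite hF => xb; exists (val b); first exact: valP.
by exists (exist _ b hb); rewrite ?hF.
Qed.

Lemma setI_setC_neq0 (T : finType) (W X : {set T}) :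
  (~: W :&: X != set0) = ~~ (X \subset W).
Proof. by rewrite setIC -setDE setD_eq0. Qed.

Definition supV (j : J) : {set ar_token} := [set inl P_n; inr (I_ j)].

(* The value at [V] is never used, as [V] is not a prerequisite. *)
Definition sup_prereq (w : ar_claim) : {set ar_token} :=
  if w is V_ j then supV j else set0.

Lemma supV_I (j : J) :
  (inr (I_ j) : ar_token) |: [set inl p | p in ar_prems (I_ j)]
    :|: \bigcup_(b in ar_prereqs (I_ j)) sup_prereq b = supV j.
Proof. by rewrite /= imset_set1 big_set0 setU0 setUC. Qed.

Lemma supB_A (j : J) :
  (inr (A_ j) : ar_token) |: [set inl p | p in ar_prems (A_ j)]
    :|: \bigcup_(b in ar_prereqs (A_ j)) sup_prereq b = supB j.
Proof.
rewrite /= imset_set1 big_set1; apply/setP => x; rewrite !inE.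
by rewrite -!orbA; do !bool_congr.
Qed.

Lemma supG_star :
  (inr J_star : ar_token) |: [set inl p | p in ar_prems J_star]
    :|: \bigcup_(b in ar_prereqs J_star) sup_prereq b = supG.
Proof.
rewrite /= imset0 !bigcup_setU !big_set1; apply/setP => x; rewrite !inE.
by case: x => [[|[]]|[[]|[]|]].
Qed.

Lemma supB_subset_G (j : J) : ~~ (supB j \subset supG).
Proof.
by apply/subsetPn; exists (inr (A_ j)); rewrite !inE ?eqxx ?orbT //; case: j.
Qed.

Lemma supG_subset_B (j : J) : ~~ (supG \subset supB j).
Proof.
by apply/subsetPn; exists (inr J_star); rewrite !inE ?eqxx ?orbT //; case: j.
Qed.

(** The root artifact [A_ j] occurs in no other branch support. *)
Lemma supB_subset_B (j k : J) : supB j \subset supB k -> j = k.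
Proof.
move/subsetP/(_ (inr (A_ j))); rewrite !inE eqxx !orbT => /(_ isT).
by case: j; case: k.
Qed.

(** This bounds the height of derivation trees: no derivation of [V] is nested inside another
    one. *)
Lemma prereq_neq_V (a : ar_artifact) (b : ar_claim) :
  b \in ar_prereqs a -> b != V.
Proof. by case: a => [j|j|]; case: b; rewrite //= !inE. Qed.

Section ArKernel.

Variable di : branch_derivations.
Let K := arK di.

(** The root artifact determines the support, because its subtrees end in claims [V_ k], where the
    induction hypothesis leaves a single possibility. Treating all claims in one [match] lets the
    induction on the indexed family [dtree] go through. *)
Lemma tsupport_arK (w : claim K) (t : dtree w) :
  match w with
  | V => tsupport t = supG \/ exists j, tsupport t = supB j
  | V_ j => tsupport t = supV j
  end.
Proof.
elim: t => a sub IH.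
have hF b : tsupport (sub b) = sup_prereq (val b).
  (* For [V_ k] the induction hypothesis is the goal; only the impossible prerequisite [V]
     remains. *)
  move: b (IH b) => [[|k] hb] //= _.
  by have := prereq_neq_V hb.
move: (tsupport_DNode hF); case: a {IH hF} sub => [j|j|] sub e.
- by rewrite /= -supV_I; exact: e.
- by right; exists j; rewrite -supB_A; exact: e.
- by left; rewrite -supG_star; exact: e.
Qed.

Lemma tsupport_prereq (a : artifact K)
    (b : {b : claim K | b \in art_prereqs a}) (t : dtree (val b)) :
  tsupport t = sup_prereq (val b).
Proof.
move: (tsupport_arK t); case: b t => -[|k] hb t //= _.
by have := prereq_neq_V hb.
Qed.

Definition tree_I (j : J) : @dtree K (V_ j).
Proof.
by refine (@DNode K (I_ j) _) => -[b hb]; exfalso; move: hb; rewrite inE.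
Defined.

(** Any choice of trees would do: [tsupport_prereq] gives their supports without unfolding them. *)
Definition tree_prereq (a : artifact K)
    (b : {b : claim K | b \in art_prereqs a}) : dtree (val b).
Proof.
case: b => -[|k] hb; last exact: tree_I.
by have := prereq_neq_V hb.
Defined.

Lemma complete_support_B (j : J) : @complete_support K V (supB j).
Proof.
exists (DNode (@tree_prereq (A_ j))); rewrite -supB_A.
by apply: (@tsupport_DNode K) => b; exact: tsupport_prereq.
Qed.

Lemma complete_support_G : @complete_support K V supG.
Proof.
exists (DNode (@tree_prereq J_star)); rewrite -supG_star.
by apply: (@tsupport_DNode K) => b; exact: tsupport_prereq.
Qed.

Lemma complete_supportP (X : {set token K}) :
  @complete_support K V X <-> X = supG \/ exists j : J, X = supB j.
Proof.
split=> [[t <-]|[->|[j ->]]]; first exact: (tsupport_arK t).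
- exact: complete_support_G.
- exact: complete_support_B.
Qed.

(** Minimality discards nothing, since the complete supports are pairwise incomparable. *)
Lemma minimal_complete_supportP (X : {set token K}) :
  @minimal_complete_support K V X <-> X = supG \/ exists j : J, X = supB j.
Proof.
split=> [[/complete_supportP]//|hX]; split; first exact/complete_supportP.
move=> Y /complete_supportP hY.
case: hY => [->|[k ->]]; case: hX => [->|[j ->]] //.
- by move=> h; case/negP: (supG_subset_B j).
- by move=> h; case/negP: (supB_subset_G k).
- by move/supB_subset_B=> ->.
Qed.

Lemma survivingP (S : numsg) (W : {set token K}) : nleft S = 13 ->
  (exists t : @dtree K V, sound S t /\ survives W t) <->
  (supG \subset W \/ exists2 j : J, j \in Jof S & supB j \subset W).
Proof.
move=> hn; split=> [[t [ht tW]]|].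
  case: (tsupport_arK t) => [e|[j e]]; first by left; rewrite -e.
  right; exists j; last by rewrite -e.
  (* The premise [P_ j] lies in [supB j], so soundness of [t] yields [H j S]. *)
  by rewrite inE; apply: (ht (P_ j)); rewrite e !inE eqxx !orbT.
case=> [GW|[j jS BW]].
  have [t e] := complete_support_G; exists t; split; last by rewrite /survives e.
  (* [P_n] holds by [hn], and no [P_ k] lies in [supG]. *)
  by case=> [|k] //; rewrite e !inE.
have [t e] := complete_support_B j; exists t; split; last by rewrite /survives e.
(* Besides [P_n], the only premise in [supB j] is [P_ j] itself. *)
case=> [|k] //; rewrite e !inE /= !orbF => /eqP [->].
by rewrite inE in jS.
Qed.

End ArKernel.

Theorem proposition13p1 (S : numsg) (hn : nleft S = 13)
    (di : branch_derivations) :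
  let K := arK di in
  [/\ forall X : {set token K},
        @minimal_complete_support K V X <-> X = supG \/ exists j : J, X = supB j,
      forall W : {set token K},
        (exists t : @dtree K V, sound S t /\ survives W t) <->
        (supG \subset W \/ exists2 j : J, j \in Jof S & supB j \subset W)
    & forall W D : {set token K}, D = ~: W ->
        ((forall t : @dtree K V, sound S t -> ~ survives W t) <->
         (D :&: supG != set0 /\
          forall j : J, j \in Jof S -> D :&: supB j != set0))].
Proof.
move=> K; split=> [X|W|W _ ->].
- exact: minimal_complete_supportP.
- exact: survivingP.
rewrite setI_setC_neq0; split=> [h|[hG hB] t st tW].
  (* Inclusion is boolean, so refuting the whole disjunction gives each non-inclusion separately. *)
  have nS : ~ (supG \subset W \/ exists2 j, j \in Jof S & supB j \subset W).
    by move/(survivingP W hn) => [t [st tW]]; exact: (h t).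
  split=> [|j jS]; first by apply/negP => GW; apply: nS; left.
  by rewrite setI_setC_neq0; apply/negP => BW; apply: nS; right; exists j.
have [GW|[j jS BW]] := (survivingP W hn).1 (ex_intro _ t (conj st tW)).
  by rewrite GW in hG.
by move: (hB j jS); rewrite setI_setC_neq0 BW.
Qed.
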